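(* Let $\gamma$ be real and $\mu>-1/2$. For each $n\ge0$ the limit $$Y_n(x)=Y_n(x;\mu,\gamma)=\lim_{\beta\to\infty}\beta^{n/2}\,C_n\!\left(\beta^{-1/2}x;\,\mu-\tfrac12,\,\beta,\,\beta^{-1/2}\gamma\right)$$ of Chihara polynomials exists, and the monic polynomials $Y_n$ have the following properties. (i) $$Y_{2n}(x)=(-1)^n(\mu+\tfrac12)_n\,{}_1F_1\!\left[{-n\atop \mu+1/2};x^2-\gamma^2\right],\qquad Y_{2n+1}(x)=(-1)^n(\mu+\tfrac32)_n(x-\gamma)\,{}_1F_1\!\left[{-n\atop \mu+3/2};x^2-\gamma^2\right].$$ (ii) $$xY_n(x)=Y_{n+1}(x)+(-1)^n\gamma Y_n(x)+\vartheta_nY_{n-1}(x),\qquad \vartheta_{2n}=n,\quad \vartheta_{2n+1}=n+\mu+\tfrac12.$$ (iii) For an arbitrary parameter $\epsilon$, $\mathcal{Z}^{(\epsilon)}Y_n(x)=\lambda_n^{(\epsilon)}Y_n(x)$ with $\lambda_{2n}^{(\epsilon)}=n$, $\lambda_{2n+1}^{(\epsilon)}=n+\epsilon$, where $$\mathcal{Z}^{(\epsilon)}=S_x\partial_x^2-T_x\partial_xR+U_x\partial_x+V_x(\mathbb{I}-R),$$ $$S_x=\frac{\gamma^2-x^2}{4x^2},\qquad T_x=\frac{\gamma(x-\gamma)}{4x^3},\qquad U_x=\frac x2+\frac{\gamma}{4x^2}-\frac{\gamma^2}{2x^3}-\frac{\mu+\gamma^2}{2x},$$ $$V_x=\frac{3\gamma^2}{8x^4}-\frac{\gamma}{4x^3}+\frac{\mu+\gamma^2}{4x^2}+\epsilon\,\frac{x-\gamma}{2x}-\frac14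 .$$ (iv) With $\mathcal{S}=(-\infty,-|\gamma|]\cup[|\gamma|,\infty)$ and $w(x)=\theta(x)(x+\gamma)(x^2-\gamma^2)^{\mu-1/2}e^{-x^2}$, $$\int_{\mathcal{S}}Y_n(x)Y_m(x)w(x)\,\mathrm{d}x=l_n\delta_{nm},\qquad l_{2n}=n!\,e^{-\gamma^2}\Gamma(n+\mu+\tfrac12),\quad l_{2n+1}=n!\,e^{-\gamma^2}\Gamma(n+\mu+\tfrac32).$$
   Context: The Chihara polynomials $C_n(x;\alpha,\beta,\gamma)$ are the monic polynomials $$C_{2n}(x)=(-1)^n\frac{(\alpha+1)_n}{(n+\alpha+\beta+1)_n}\,{}_2F_1\!\left[{-n,\;n+\alpha+\beta+1\atop \alpha+1};x^2-\gamma^2\right],$$ $$C_{2n+1}(x)=(-1)^n\frac{(\alpha+2)_n}{(n+\alpha+\beta+2)_n}(x-\gamma)\,{}_2F_1\!\left[{-n,\;n+\alpha+\beta+2\atop \alpha+2};x^2-\gamma^2\right].$$ Here $(a)_n=a(a+1)\cdots(a+n-1)$, $(a)_0=1$, ${}_pF_q$ is the generalized hypergeometric series, $\theta(x)$ is the sign function, $Rf(x)=f(-x)$, $\mathbb{I}$ is the identity, and $\partial_xR$ means first apply $R$ and then differentiate, i.e. $(\partial_xRf)(x)=-f'(-x)$. Convention: $Y_{-1}=0$. *)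

(* Defs.v *)
From mathcomp Require Import all_boot all_order all_algebra.
From mathcomp Require Import all_classical all_reals all_analysis.
Import Order.TTheory GRing.Theory Num.Theory.
Import numFieldNormedType.Exports.

Set Implicit Arguments.
Unset Strict Implicit.
Unset Printing Implicit Defensive.

Local Open Scope classical_set_scope.
Local Open Scope ring_scope.

Section Chihara.
Variable R : realType.
Implicit Types (a b z x alpha beta gamma mu eps t : R) (n k : nat).

Definition poch a n : R := \prod_(i < n) (a + i%:R).

(* Generalized hypergeometric series pFq with numerator parameters [nums] and
   denominator parameters [dens], as the sum of the full infinite series; it
   terminates when some numerator parameter is a nonpositive integer. *)
Definition hypergeom (nums dens : seq R) z : R :=
  limn (series (fun k =>
    (\prod_(a <- nums) poch a k) / (\prod_(b <- dens) poch b k)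
    * (z ^+ k / k`!%:R))).

(* The polynomial C_N, with [n] = N./2 in both parities. *)
Definition chihara (N : nat) x alpha beta gamma : R :=
  let n := N./2 in
  if odd N then
    (-1) ^+ n * (poch (alpha + 2) n / poch (n%:R + alpha + beta + 2) n)
    * (x - gamma)
    * hypergeom [:: - n%:R; n%:R + alpha + beta + 2] [:: alpha + 2]
        (x ^+ 2 - gamma ^+ 2)
  else
    (-1) ^+ n * (poch (alpha + 1) n / poch (n%:R + alpha + beta + 1) n)
    * hypergeom [:: - n%:R; n%:R + alpha + beta + 1] [:: alpha + 1]
        (x ^+ 2 - gamma ^+ 2).

Definition chihara_scaled mu gamma n x beta : R :=
  beta `^ (n%:R / 2)
  * chihara n (beta `^ (- (1 / 2)) * x) (mu - 1 / 2) beta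
      (beta `^ (- (1 / 2)) * gamma).

Definition Y mu gamma n x : R :=
  lim (chihara_scaled mu gamma n x beta @[beta --> +oo]).

Definition vartheta mu n : R :=
  if odd n then (n./2)%:R + mu + 1 / 2 else (n./2)%:R.

Definition lambda eps n : R :=
  if odd n then (n./2)%:R + eps else (n./2)%:R.

(* The reflection operator; [derive1 (refl f)] is the operator "reflect first,
   then differentiate". *)
Definition refl (f : R -> R) : R -> R := fun x => f (- x).

Definition Sx gamma x : R := (gamma ^+ 2 - x ^+ 2) / (4 * x ^+ 2).

Definition Tx gamma x : R := gamma * (x - gamma) / (4 * x ^+ 3).

Definition Ux mu gamma x : R :=
  x / 2 + gamma / (4 * x ^+ 2) - gamma ^+ 2 / (2 * x ^+ 3)
  - (mu + gamma ^+ 2) / (2 * x).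

Definition Vx mu gamma eps x : R :=
  3 * gamma ^+ 2 / (8 * x ^+ 4) - gamma / (4 * x ^+ 3)
  + (mu + gamma ^+ 2) / (4 * x ^+ 2) + eps * ((x - gamma) / (2 * x)) - 1 / 4.

(* The coefficients have a pole at 0, so this is meaningful for x != 0 only. *)
Definition Zop mu gamma eps (f : R -> R) : R -> R := fun x =>
  Sx gamma x * derive1n 2 f x - Tx gamma x * derive1 (refl f) x
  + Ux mu gamma x * derive1 f x + Vx mu gamma eps x * (f x - refl f x).

Definition support_set gamma : set R :=
  `]-oo, - `|gamma|] `|` `[`|gamma|, +oo[.

Definition weight mu gamma x : R :=
  Num.sg x * (x + gamma) * (x ^+ 2 - gamma ^+ 2) `^ (mu - 1 / 2)
  * expR (- x ^+ 2).

(* Euler's integral, convergent for 0 < a. *)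
Definition Gamma a : R :=
  \int[lebesgue_measure]_(t in `]0, +oo[) (t `^ (a - 1) * expR (- t)).

Definition norm_const mu gamma n : R :=
  if odd n then (n./2)`!%:R * expR (- gamma ^+ 2)
                * Gamma ((n./2)%:R + mu + 3 / 2)
  else (n./2)`!%:R * expR (- gamma ^+ 2) * Gamma ((n./2)%:R + mu + 1 / 2).

End Chihara.

(* Main.v *)
From HB Require Import structures.
Require Import Defs.
From mathcomp Require Import all_boot all_order all_algebra.
From mathcomp Require Import all_classical all_reals all_analysis.
From mathcomp Require Import measurable_realfun.
From mathcomp Require Import ring lra.
Import Order.TTheory GRing.Theory Num.Theory.
Import numFieldNormedType.Exports.

(* With t = x^2 - gamma^2 and b = mu + 1/2, the limit turns the terminating 2F1
   into a 1F1, so Y_(2n) is the monic Laguerre polynomial L_n^b(t) of weight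
   t^(b-1) e^(-t) and Y_(2n+1) is (x - gamma) L_n^(b+1)(t). The recurrence then
   splits into the two contiguity relations between L^b and L^(b+1), and the
   eigenvalue equation reduces to Laguerre's differential equation. For the
   orthogonality, adding the contributions of x and -x to the integral leaves
   2x dx times a polynomial in t, and substituting t reduces it to the
   orthogonality of Laguerre polynomials. The latter is algebraic: only the
   moments Gamma(b + k) = Gamma(b) (b)_k matter, and the functional they define
   makes Laguerre's operator self-adjoint. *)

Set Implicit Arguments.
Unset Strict Implicit.
Unset Printing Implicit Defensive.

Local Open Scope classical_set_scope.
Local Open Scope ring_scope.

(** Confluence comes from the scaling: with x and gamma both multiplied by beta^(-1/2), the argument
    of the 2F1 is t / beta, while its second numerator parameter grows like beta, so each term of
    the finite sum converges by itself. The analytic difficulty lies in the orthogonality. The rays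
    are unbounded, and for mu < 1/2 the density t^(mu-1/2) e^(-t) blows up at t = 0, that is at x =
    gamma and x = -gamma. Substitution and integration by parts are therefore carried out on compact
    segments inside the open ray and passed to the limit by monotone convergence; for changes of
    variable, signed integrands are split into positive and negative parts. Moreover the
    contributions of x and -x can be added only once each is known to be integrable, and neither is
    in general 2x times a function of t; a majorant of that form settles this. *)

Section Pochhammer.
Variable R : realType.
Implicit Types (a b z : R) (n k : nat).

Lemma poch0 a : poch a 0 = 1.
Proof. by rewrite /poch big_ord0. Qed.

Lemma pochS a n : poch a n.+1 = poch a n * (a + n%:R).
Proof. by rewrite /poch big_ord_recr. Qed.

Lemma pochSl a n : poch a n.+1 = a * poch (a + 1) n.
Proof.
rewrite /poch big_ord_recl /= addr0; congr (_ * _).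
by apply: eq_bigr => i _; rewrite /bump leq0n add1n -addrA nat1r.
Qed.

Lemma poch_gt0 a n : 0 < a -> 0 < poch a n.
Proof. by move=> a0; apply: prodr_gt0 => i _; rewrite ltr_wpDr. Qed.

Lemma poch_neq0 a n : 0 < a -> poch a n != 0.
Proof. by move=> a0; rewrite gt_eqF ?poch_gt0. Qed.

Lemma pochN_gt n k : (n < k)%N -> poch (- n%:R : R) k = 0.
Proof.
by move=> nk; rewrite /poch (bigD1 (Ordinal nk)) //= addNr mul0r.
Qed.

Lemma pochN_diag n : poch (- n%:R : R) n = (-1) ^+ n * n`!%:R.
Proof.
elim: n => [|n IHn]; first by rewrite poch0 fact0 mulr1.
rewrite pochSl factS natrM exprS.
have -> : - n.+1%:R + 1 = - n%:R :> R by rewrite -natr1 opprD addrNK.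
by rewrite IHn; ring.
Qed.

Lemma poch_shift a k : a * poch (a + 1) k = poch a k * (a + k%:R).
Proof. by rewrite -pochSl pochS. Qed.

(** The factor [poch (- n%:R) k] vanishes for k > n, so the partial sums are constant from index
    [n.+1] on. *)
Lemma hypergeom_terminating n (nums dens : seq R) z :
  hypergeom (- n%:R :: nums) dens z =
  \sum_(k < n.+1) (\prod_(a <- - n%:R :: nums) poch a k)
                  / (\prod_(b <- dens) poch b k) * (z ^+ k / k`!%:R).
Proof.
rewrite /hypergeom; apply: cvg_lim => //.
apply: cvg_near_cst; exists n.+1 => // m /= nm.
set F := fun k : nat => _.
rewrite seriesEord /= (big_ord_widen m F nm) [RHS]big_mkcond /=.
apply: eq_bigr => k _; case: ltnP => // nk.
by rewrite /F big_cons pochN_gt // !mul0r.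
Qed.

End Pochhammer.

(** * Monic Laguerre polynomials: contiguity relations and differential equation *)

Section Laguerre.
Variable R : realType.
Implicit Types (a b z : R) (n k : nat) (p q : {poly R}).

(** In classical notation this is (-1)^n n! L_n^(b-1). *)
Definition laguerre b n : {poly R} :=
  \poly_(k < n.+1)
    ((-1) ^+ n * poch b n * (poch (- n%:R) k / poch b k / k`!%:R)).

Lemma coef_laguerre b n k :
  (laguerre b n)`_k =
  (-1) ^+ n * poch b n * (poch (- n%:R) k / poch b k / k`!%:R).
Proof.
by rewrite coef_poly; case: ltnP => // /pochN_gt ->; rewrite !mul0r mulr0.
Qed.

Lemma laguerre0 b : laguerre b 0 = 1.
Proof.
apply/polyP => -[|k]; rewrite coef_laguerre coef1.
  by rewrite !poch0 fact0 expr0 !divr1 !mul1r.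
by rewrite pochN_gt // !mul0r mulr0.
Qed.

Lemma horner_laguerre b n z :
  (laguerre b n).[z] =
  (-1) ^+ n * poch b n * hypergeom [:: - n%:R] [:: b] z.
Proof.
rewrite hypergeom_terminating horner_poly mulr_sumr.
by apply: eq_bigr => k _; rewrite !big_seq1; ring.
Qed.

Lemma coef_laguerre_lead b n : 0 < b -> (laguerre b n)`_n = 1.
Proof.
move=> b0; rewrite coef_laguerre pochN_diag.
have := poch_neq0 n b0; have : n`!%:R != 0 :> R by rewrite pnatr_eq0 -lt0n fact_gt0.
move=> h1 h2; transitivity ((-1) ^+ n * (-1) ^+ n : R); first by field; rewrite h1 h2.
by rewrite -exprMn mulrNN mulr1 expr1n.
Qed.

Lemma size_laguerre b n : 0 < b -> size (laguerre b n) = n.+1.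
Proof.
move=> b0; rewrite size_poly_eq // -coef_laguerre coef_laguerre_lead //.
Qed.

Lemma laguerre_monic b n : 0 < b -> laguerre b n \is monic.
Proof.
by move=> b0; rewrite monicE lead_coefE size_laguerre ?coef_laguerre_lead.
Qed.

(** Monic form of the classical L_n^(a) = L_n^(a+1) - L_(n-1)^(a+1), with a = b - 1 and n raised by
    one. *)
Lemma laguerreS_addr1 b n : 0 < b ->
  laguerre b n.+1 = laguerre (b + 1) n.+1 + n.+1%:R *: laguerre (b + 1) n.
Proof.
move=> b0; have b10 : 0 < b + 1 by rewrite addr_gt0.
apply/polyP => k; rewrite coefD coefZ !coef_laguerre.
have bN0 : b != 0 by rewrite gt_eqF.
have bk0 : b + k%:R != 0 by rewrite gt_eqF // ltr_wpDr.
have pk : poch (b + 1) k = poch b k * (b + k%:R) / b.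
  by rewrite -poch_shift mulrAC divff ?mul1r.
(* Up to sign, both products are (-(n+1))_(k+1). Written without dividing by n + 1 - k, the identity
   also covers k = n + 1. *)
have pn : n.+1%:R * poch (- n%:R) k = poch (- n.+1%:R) k * (n.+1%:R - k%:R) :> R.
  have -> : n.+1%:R - k%:R = - (- n.+1%:R + k%:R) :> R by rewrite opprD opprK.
  rewrite mulrN -poch_shift -mulNr opprK; congr (_ * poch _ _).
  by rewrite -natr1 opprD addrNK.
rewrite pk pochSl pochS.
have k0 : k`!%:R != 0 :> R by rewrite pnatr_eq0 -lt0n fact_gt0.
have p0 := poch_neq0 k b0.
rewrite -natr1 in pn *.
transitivity ((-1) ^+ n.+1 * (poch (b + 1) n * (b + 1 + n%:R)) *
 (poch (- (n%:R + 1)) k / (poch b k * (b + k%:R) / b) / k`!%:R) +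
 (-1) ^+ n * poch (b + 1) n * (((n%:R + 1) * poch (- n%:R) k) /
   (poch b k * (b + k%:R) / b) / k`!%:R)); last by ring.
by rewrite pn exprS; field; rewrite k0 p0 bN0 bk0.
Qed.

(** Monic form of the classical t L_n^(a+1) = (n + a + 1) L_n^(a) - (n + 1) L_(n+1)^(a), with a = b
    - 1. *)
Lemma mulX_laguerre b n : 0 < b ->
  'X * laguerre (b + 1) n = laguerre b n.+1 + (n%:R + b) *: laguerre b n.
Proof.
move=> b0; have b10 : 0 < b + 1 by rewrite addr_gt0.
apply/polyP => -[|k]; rewrite coefXM coefD coefZ !coef_laguerre.
  by rewrite !poch0 fact0 pochS exprS /=; field.
rewrite /= [poch (- n.+1%:R) _]pochSl [poch b k.+1]pochSl [poch b n.+1]pochS.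
have -> : - n.+1%:R + 1 = - n%:R :> R by rewrite -natr1 opprD addrNK.
have E : poch b n = b * poch (b + 1) n / (b + n%:R).
  by rewrite poch_shift mulfK // gt_eqF // ltr_wpDr.
rewrite E pochS factS natrM exprS -!natr1.
have k0 : k`!%:R != 0 :> R by rewrite pnatr_eq0 -lt0n fact_gt0.
have k1 : k%:R + 1 != 0 :> R by rewrite natr1 pnatr_eq0.
have p0 := poch_neq0 k b10.
have bn0 : b + n%:R != 0 by rewrite gt_eqF // ltr_wpDr.
have bN0 : b != 0 by rewrite gt_eqF.
by field; rewrite k0 k1 p0 bn0 bN0.
Qed.

Lemma laguerre_ode b n : 0 < b ->
  'X * (laguerre b n)^`()^`() + (b%:P - 'X) * (laguerre b n)^`() =
  - n%:R *: laguerre b n.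
Proof.
move=> b0.
(* The ratio of consecutive 1F1 coefficients; Laguerre's equation is this two-term recursion, read
   off at t^k. *)
have step k : (k%:R + 1) * (k%:R + b) * (laguerre b n)`_k.+1 =
              (k%:R - n%:R) * (laguerre b n)`_k.
  rewrite !coef_laguerre !pochS factS natrM -!natr1.
  have k0 : k`!%:R != 0 :> R by rewrite pnatr_eq0 -lt0n fact_gt0.
  have k1 : k%:R + 1 != 0 :> R by rewrite natr1 pnatr_eq0.
  have p0 := poch_neq0 k b0.
  have bk0 : b + k%:R != 0 by rewrite gt_eqF // ltr_wpDr.
  by field; rewrite k0 k1 p0 bk0.
apply/polyP => k; rewrite mulrBl coefD coefB coefZ coefCM !coefXM !coef_deriv.
have := step k; case: k => [|k] /= s.
  by rewrite mulr1n add0r subr0; move: s; rewrite !add0r mul1r.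
move: s; move: (_`_k.+1) (_`_k.+2) => c1 c2 /eqP s.
apply/eqP; rewrite -subr_eq0; move: s; rewrite -subr_eq0.
by congr (_ == _); ring.
Qed.

End Laguerre.

(** * The moment functional of the Gamma density and algebraic orthogonality *)

Section GammaMoment.
Variable R : realType.
Implicit Types (a b z : R) (n k : nat) (p q : {poly R}).

(* [moment b p] is the integral of [p(t) t^(b-1) e^(-t)] over [t > 0], divided
   by [Gamma b]. *)
Definition moment b p : R := \sum_(k < size p) p`_k * poch b k.

Lemma moment_widen b p N : (size p <= N)%N ->
  moment b p = \sum_(k < N) p`_k * poch b k.
Proof.
move=> pN; rewrite /moment (big_ord_widen N (fun k => p`_k * poch b k) pN).
rewrite big_mkcond; apply: eq_bigr => k _.
by case: ltnP => // kp; rewrite nth_default // mul0r.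
Qed.

Fact moment_is_linear b : scalar (moment b).
Proof.
move=> a p q; set N := maxn (size (a *: p + q)) (maxn (size p) (size q)).
rewrite !(@moment_widen b _ N) ?leq_max ?leqnn ?orbT //.
rewrite mulr_sumr -big_split /=; apply: eq_bigr => k _.
by rewrite coefD coefZ; ring.
Qed.

HB.instance Definition _ b :=
  GRing.isLinear.Build R {poly R} R _ (moment b) (moment_is_linear b).

Lemma momentXn b k : moment b 'X^k = poch b k.
Proof.
rewrite /moment size_polyXn big_ord_recr /= coefXn eqxx mul1r.
rewrite big1 ?add0r // => i _; rewrite coefXn ltn_eqF ?mul0r //.
Qed.

(** A factor t raises the parameter of the density by one; [b] is the quotient Gamma (b + 1) / Gamma
    b of the two normalisations. *)
Lemma momentS b p : b * moment (b + 1) p = moment b ('X * p).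
Proof.
rewrite (@moment_widen b _ (size p).+1); last first.
  by rewrite (leq_trans (size_mul_leq _ _)) // size_polyX.
rewrite big_ord_recl coefXM mul0r add0r /moment mulr_sumr.
apply: eq_bigr => k _; rewrite coefXM /= /bump leq0n add1n.
by rewrite pochSl; ring.
Qed.

(** Times t^(b-1) e^(-t), the argument is the derivative of p(t) t^b e^(-t), which vanishes at both
    ends. Algebraically the terms cancel for each k, since b (b+1)_k = (b)_k (b + k). *)
Lemma moment_by_parts b p :
  moment b (b *: p + 'X * p^`() - 'X * p) = 0.
Proof.
set N := (size p).+1; rewrite linearB linearD linearZ /=.
rewrite -(momentS b p) (@moment_widen b p N) // (@moment_widen b ('X * _) N); last first.
  rewrite (leq_trans (size_mul_leq _ _)) // size_polyX.
  by rewrite add2n /N ltnS (leq_trans (size_poly _ _)) ?leq_pred.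
rewrite (@moment_widen _ _ N) // !mulr_sumr -big_split /= -sumrB.
rewrite big1 // => k _; rewrite coefXM coef_deriv.
rewrite (mulrCA b _ (poch (b + 1) k)) poch_shift.
by case: (nat_of_ord k) => [|j] /=; ring.
Qed.

(** The right side is symmetric in n and m, so the factors n and m on the left give the same value,
    which forces orthogonality. It results from integrating by parts with L_n' L_m and eliminating
    L_n'' by Laguerre's equation. *)
Lemma moment_laguerre_self_adjoint b n m : 0 < b ->
  n%:R * moment b (laguerre b n * laguerre b m) =
  moment b ('X * (laguerre b n)^`() * (laguerre b m)^`()).
Proof.
move=> b0; have := moment_by_parts b ((laguerre b n)^`() * laguerre b m).
have -> : b *: ((laguerre b n)^`() * laguerre b m) +
    'X * ((laguerre b n)^`() * laguerre b m)^`() -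
    'X * ((laguerre b n)^`() * laguerre b m) =
    - n%:R *: (laguerre b n * laguerre b m) +
    'X * (laguerre b n)^`() * (laguerre b m)^`().
  by rewrite (scalerAl (- n%:R)) -laguerre_ode // derivM -mul_polyC; ring.
by rewrite linearD linearZ /= mulNr => /eqP; rewrite addrC subr_eq0 => /eqP.
Qed.

Lemma moment_laguerre_neq b n m : 0 < b -> n != m ->
  moment b (laguerre b n * laguerre b m) = 0.
Proof.
move=> b0 nm; have := moment_laguerre_self_adjoint n m b0.
rewrite mulrAC -moment_laguerre_self_adjoint // [laguerre b m * _]mulrC.
move/eqP; rewrite -subr_eq0 -mulrBl mulf_eq0 subr_eq0 eqr_nat (negbTE nm) /=.
by move/eqP.
Qed.

(* Both [moment b ('X * L_n^(b+1) * L_n^b)] and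
   [moment b ('X * L_n^(b+1) * L_(n+1)^b)] are evaluated in two ways, expanding
   either ['X * L_n^(b+1)] or the other factor by a contiguity relation; comparing
   them gives [h_(n+1) = (n + 1) (b + n) h_n] for the squared norms. *)
Lemma moment_laguerre_sqr b n : 0 < b ->
  moment b (laguerre b n * laguerre b n) = n`!%:R * poch b n.
Proof.
move=> b0; have b10 : 0 < b + 1 by rewrite addr_gt0.
elim: n => [|n IHn].
  by rewrite laguerre0 mulr1 -(expr0 'X) momentXn fact0 poch0 mulr1.
have E1 : moment b ('X * laguerre (b + 1) n * laguerre b n) =
          (n%:R + b) * moment b (laguerre b n * laguerre b n).
  by rewrite mulX_laguerre // mulrDl linearD -scalerAl linearZ /= 
     moment_laguerre_neq ?add0r // gtn_eqF.
have E2 : moment b ('X * laguerre (b + 1) n * laguerre b n.+1) =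
          moment b (laguerre b n.+1 * laguerre b n.+1).
  by rewrite mulX_laguerre // mulrDl linearD -scalerAl linearZ /= 
     [X in _ + _ * X]moment_laguerre_neq ?mulr0 ?addr0 // ltn_eqF.
have E1' : moment b ('X * laguerre (b + 1) n * laguerre b n) =
           b * moment (b + 1) (laguerre (b + 1) n * laguerre (b + 1) n).
  rewrite -mulrA -momentS; congr (_ * _).
  (* The relation [laguerreS_addr1] starts in degree one, so degree zero is separate. *)
  case: n {IHn E1 E2} => [|n].
    by rewrite !laguerre0.
  rewrite (laguerreS_addr1 n b0) mulrDr linearD -scalerAr linearZ /=.
  by rewrite [X in _ + _ * X]moment_laguerre_neq ?mulr0 ?addr0 // gtn_eqF.
have E2' : moment b ('X * laguerre (b + 1) n * laguerre b n.+1) =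
           b * (n.+1%:R * moment (b + 1) (laguerre (b + 1) n * laguerre (b + 1) n)).
  rewrite -mulrA -momentS; congr (_ * _).
  rewrite (laguerreS_addr1 n b0) mulrDr linearD -scalerAr linearZ /=.
  by rewrite moment_laguerre_neq ?add0r // ltn_eqF.
rewrite -E2 E2' mulrCA -E1' E1 IHn factS natrM pochS; ring.
Qed.

End GammaMoment.

(** * The confluent limit from Chihara polynomials to Laguerre polynomials *)

Section Limit.
Variable R : realType.
Implicit Types (a b s x z mu gamma : R) (n k : nat).

Lemma cvg_poch_div s k :
  poch (s + x) k / x ^+ k @[x --> +oo] --> (1 : R).
Proof.
elim: k => [|k IHk].
  rewrite (_ : (fun _ => _) = cst 1); first exact: cvg_cst.
  by apply/funext => x; rewrite poch0 expr0 divr1.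
rewrite -[1 in X in _ --> X]mulr1.
suff h : (1 + (s + k%:R) * x^-1) @[x --> +oo] --> (1 : R).
  apply: cvg_trans (cvgM IHk h); apply: near_eq_cvg; near=> x.
  have x0 : x != 0 by rewrite gt_eqF //; near: x; exact: nbhs_pinfty_gt.
  by rewrite /= pochS exprS; field; rewrite x0 expf_neq0.
rewrite -[X in _ --> X]addr0 -(mulr0 (s + k%:R)).
apply: cvgD; first exact: cvg_cst.
apply: cvgM; first exact: cvg_cst.
apply/(@gtr0_cvgV0 _ _ _ _ id); last exact: cvg_id.
exact: nbhs_pinfty_gt.
Unshelve. all: by end_near. Qed.

(* Up to the factor [x - gamma], this is the Chihara polynomial of both parities
   when beta = [x], [s + x] being the second numerator parameter of the 2F1. *)
Definition chihara_core s b n z x : R :=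
  (-1) ^+ n * (poch b n / poch (s + x) n) *
  hypergeom [:: - n%:R; s + x] [:: b] (x^-1 * z).

Lemma cvg_chihara_core s b n z :
  x ^+ n * chihara_core s b n z x @[x --> +oo] --> (laguerre b n).[z].
Proof.
(* Each Pochhammer symbol in s + x is paired with its own power of x, leaving only factors that tend
   to 1. The two conditions, which keep the denominators nonzero, hold for all large x. *)
have E x : x != 0 -> 0 < s + x -> x ^+ n * chihara_core s b n z x =
   (-1) ^+ n * poch b n * (poch (s + x) n / x ^+ n)^-1 *
   \sum_(k < n.+1) (poch (- n%:R) k / poch b k * (z ^+ k / k`!%:R)) *
                   (poch (s + x) k / x ^+ k).
  move=> x0 sx0; rewrite /chihara_core hypergeom_terminating.
  rewrite !mulrA; congr (_ * _).
    by field; rewrite poch_neq0 // expf_neq0.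
  apply: eq_bigr => k _.
  rewrite !big_cons !big_nil !mulr1 exprMn exprVn.
  by ring.
have -> : (laguerre b n).[z] = (-1) ^+ n * poch b n * 1^-1 *
   \sum_(k < n.+1) (poch (- n%:R) k / poch b k * (z ^+ k / k`!%:R)) * 1.
  rewrite horner_laguerre hypergeom_terminating invr1 mulr1; congr (_ * _).
  by apply: eq_bigr => k _; rewrite !big_seq1 mulr1.
suff h : (-1) ^+ n * poch b n * (poch (s + x) n / x ^+ n)^-1 *
    \sum_(k < n.+1) (poch (- n%:R) k / poch b k * (z ^+ k / k`!%:R)) *
      (poch (s + x) k / x ^+ k) @[x --> +oo] -->
    (-1) ^+ n * poch b n * 1^-1 *
    \sum_(k < n.+1) (poch (- n%:R) k / poch b k * (z ^+ k / k`!%:R)) * 1.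
  apply: cvg_trans h; apply: near_eq_cvg; near=> x; rewrite E //.
    by rewrite gt_eqF //; near: x; exact: nbhs_pinfty_gt.
  rewrite -(opprK s) addrC subr_gt0.
  by near: x; apply: nbhs_pinfty_gt; rewrite num_real.
apply: cvgM.
  apply: cvgM; first exact: cvg_cst.
  by apply: cvgV; [exact: oner_neq0|exact: (cvg_poch_div s n)].
apply: cvg_big => [|k _]; first exact: add_continuous.
apply: cvgM; first exact: cvg_cst.
exact: (cvg_poch_div s k).
Unshelve. all: by end_near. Qed.

Definition limit_poly mu gamma n : {poly R} :=
  if odd n then
    ('X - gamma%:P) * (laguerre (mu + 3 / 2) n./2 \Po ('X^2 - (gamma ^+ 2)%:P))
  else laguerre (mu + 1 / 2) n./2 \Po ('X^2 - (gamma ^+ 2)%:P).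

Lemma horner_limit_poly mu gamma n x :
  (limit_poly mu gamma n).[x] =
  if odd n then (x - gamma) * (laguerre (mu + 3 / 2) n./2).[x ^+ 2 - gamma ^+ 2]
  else (laguerre (mu + 1 / 2) n./2).[x ^+ 2 - gamma ^+ 2].
Proof. by rewrite /limit_poly; case: odd; rewrite !(hornerE, horner_comp). Qed.

Lemma horner_limit_poly_double mu gamma k x :
  (limit_poly mu gamma k.*2).[x] =
  (laguerre (mu + 1 / 2) k).[x ^+ 2 - gamma ^+ 2].
Proof. by rewrite horner_limit_poly odd_double doubleK. Qed.

Lemma horner_limit_poly_doubleS mu gamma k x :
  (limit_poly mu gamma k.*2.+1).[x] =
  (x - gamma) * (laguerre (mu + 3 / 2) k).[x ^+ 2 - gamma ^+ 2].
Proof. by rewrite horner_limit_poly /= odd_double /= uphalf_double. Qed.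

Lemma cvg_chihara_scaled mu gamma n x :
  chihara_scaled mu gamma n x beta @[beta --> +oo] -->
  (limit_poly mu gamma n).[x].
Proof.
rewrite horner_limit_poly; set z := x ^+ 2 - gamma ^+ 2.
have zE (y : R) : 0 < y -> (y `^ (- (1 / 2)) * x) ^+ 2 - (y `^ (- (1 / 2)) * gamma) ^+ 2 =
   y^-1 * z.
  move=> y0; rewrite !exprMn -mulrBr -powR_mulrn ?powR_ge0 // -powRrM.
  by rewrite (_ : - (1 / 2) * 2%:R = -1) ?powR_inv1 ?ltW //; field.
(* Splits beta^(n/2) into the integral power used by [cvg_chihara_core] and, for odd n, an extra
   beta^(1/2) that cancels the beta^(-1/2) in front of x - gamma. *)
have nE : n%:R = (odd n)%:R + 2 * (n./2)%:R :> R.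
  by rewrite -natrM mul2n -natrD odd_double_half.
rewrite /chihara_scaled /chihara; case: ifPn => on.
  have h := cvgM (@cvg_cst _ (x - gamma) _ (pinfty_nbhs R) _)
    (@cvg_chihara_core (n./2%:R + (mu + 3 / 2)) (mu + 3 / 2) n./2 z).
  apply: cvg_trans (h _ _); apply: near_eq_cvg; near=> y.
  have y0 : 0 < y by near: y; exact: nbhs_pinfty_gt.
  rewrite zE // -mulrBr nE on /chihara_core.
  rewrite (_ : mu - 1 / 2 + 2 = mu + 3 / 2); last by field.
  rewrite (_ : n./2%:R + (mu - 1 / 2) + y + 2 = n./2%:R + (mu + 3 / 2) + y); last by field.
  rewrite (_ : (1 + 2 * n./2%:R) / 2 = n./2%:R + 1 / 2); last by field.
  rewrite powRD ?(gt_eqF y0) ?implybT // powR_mulrn ?(ltW y0) // powRN.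
  rewrite /=; set c := poch _ _ / poch _ _; set F := hypergeom _ _ _.
  by field; rewrite gt_eqF // powR_gt0.
apply: cvg_trans; last first.
  exact: (@cvg_chihara_core (n./2%:R + (mu + 1 / 2)) (mu + 1 / 2) n./2 z).
apply: near_eq_cvg; near=> y.
have y0 : 0 < y by near: y; exact: nbhs_pinfty_gt.
rewrite zE // nE (negbTE on) /chihara_core.
rewrite (_ : mu - 1 / 2 + 1 = mu + 1 / 2); last by field.
rewrite (_ : n./2%:R + (mu - 1 / 2) + y + 1 = n./2%:R + (mu + 1 / 2) + y); last by field.
rewrite (_ : (0 + 2 * n./2%:R) / 2 = n./2%:R); last by field.
by rewrite powR_mulrn ?(ltW y0).
Unshelve. all: by end_near. Qed.

Lemma YE mu gamma n : Y mu gamma n = horner (limit_poly mu gamma n).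
Proof. by apply/funext => x; apply: cvg_lim => //; exact: cvg_chihara_scaled. Qed.

End Limit.

(** * Degree, recurrence and eigenvalue equation of the limit polynomials *)

Section LimitPoly.
Variables (R : realType) (mu gamma : R).
Hypothesis hmu : - (1 / 2) < mu.
Implicit Types (x : R) (n : nat).

Let b0 : 0 < mu + 1 / 2. Proof. by rewrite -(opprK (1 / 2)) subr_gt0. Qed.

Let bE : mu + 3 / 2 = (mu + 1 / 2) + 1. Proof. by field. Qed.

Let b10 : 0 < mu + 3 / 2. Proof. by rewrite bE addr_gt0. Qed.

Lemma monic_limit_poly n : limit_poly mu gamma n \is monic.
Proof.
have mL b : 0 < b -> laguerre b n./2 \Po ('X^2 - (gamma ^+ 2)%:P) \is monic.
  move=> h; rewrite monicE lead_coef_comp ?size_XnsubC //.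
  by rewrite (monicP (laguerre_monic _ h)) (monicP (monicXnsubC _ _)) ?mul1r ?expr1n.
rewrite /limit_poly; case: odd; last exact: mL.
by rewrite monicMl ?mL // monicXsubC.
Qed.

Lemma size_limit_poly n : size (limit_poly mu gamma n) = n.+1.
Proof.
have sL b : 0 < b ->
    (size (laguerre b n./2 \Po ('X^2 - (gamma ^+ 2)%:P))).-1 = n./2.*2.
  by move=> h; rewrite size_comp_poly size_laguerre // size_XnsubC //= muln2.
have m := monic_limit_poly n.
have s0 : (0 < size (limit_poly mu gamma n))%N.
  by rewrite size_poly_gt0 monic_neq0.
rewrite -(prednK s0); congr _.+1; rewrite -[RHS]odd_double_half.
move: m s0; rewrite /limit_poly; case: odd => m s0; last exact: sL.
have p0 : laguerre (mu + 3 / 2) n./2 \Po ('X^2 - (gamma ^+ 2)%:P) != 0.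
  by apply: contraTneq s0 => ->; rewrite mulr0 size_poly0.
rewrite size_monicM ?monicXsubC // size_XsubC /= -(sL _ b10) add1n prednK //.
by rewrite size_poly_gt0.
Qed.

(** In even degree x - gamma multiplies an L^b, which [E1] expands in L^(b+1). In odd degree x (x -
    gamma) = t - gamma (x - gamma), whence the opposite sign of gamma, and [E2] expands t
    L^(b+1). *)
Lemma limit_poly_recurrence n x :
  x * (limit_poly mu gamma n).[x] =
  (limit_poly mu gamma n.+1).[x]
  + (-1) ^+ n * gamma * (limit_poly mu gamma n).[x]
  + vartheta mu n * (if n is k.+1 then (limit_poly mu gamma k).[x] else 0).
Proof.
set t := x ^+ 2 - gamma ^+ 2.
have E1 k : (laguerre (mu + 1 / 2) k.+1).[t] =
    (laguerre (mu + 3 / 2) k.+1).[t] + k.+1%:R * (laguerre (mu + 3 / 2) k).[t].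
  by rewrite bE (laguerreS_addr1 k b0) hornerD hornerZ.
have E2 k : t * (laguerre (mu + 3 / 2) k).[t] =
    (laguerre (mu + 1 / 2) k.+1).[t] +
    (k%:R + (mu + 1 / 2)) * (laguerre (mu + 1 / 2) k).[t].
  have /(congr1 (horner^~ t)) := mulX_laguerre k b0.
  by rewrite -bE hornerM hornerX hornerD hornerZ.
rewrite /vartheta -signr_odd -(odd_double_half n).
case: (odd n); last first.
  rewrite add0n odd_double expr0; case: n./2 => [|k].
    by rewrite !horner_limit_poly /= !laguerre0 !hornerE; ring.
  rewrite doubleK horner_limit_poly_double horner_limit_poly_doubleS.
  by rewrite doubleS horner_limit_poly_doubleS -/t E1; ring.
rewrite add1n /= odd_double expr1 uphalf_double -doubleS.
rewrite !horner_limit_poly_double horner_limit_poly_doubleS -/t.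
have := E2 n./2; move: (horner _ _) (horner _ _) (horner _ _) => u v w e.
transitivity (t * w - gamma * (x - gamma) * w); first by rewrite /t; ring.
by rewrite e /=; ring.
Qed.

(** Reflection fixes t, so I - R annihilates Y_(2k) and turns (x - gamma) L into 2x L; the factor (x
    - gamma) / (2x) then restores (x - gamma) L. Hence [eps] is arbitrary and shifts only the odd
    eigenvalues. *)
Lemma limit_poly_eigen eps n x : x != 0 ->
  Zop mu gamma eps (horner (limit_poly mu gamma n)) x =
  lambda eps n * (limit_poly mu gamma n).[x].
Proof.
move=> x0; pose q : {poly R} := 'X^2 - (gamma ^+ 2)%:P.
have qE y : q.[y] = y ^+ 2 - gamma ^+ 2 by rewrite /q !hornerE.
have dq : q^`() = 'X *+ 2 by rewrite /q derivB derivC subr0 derivXn.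
have ode b k : 0 < b -> k%:R * (laguerre b k).[x ^+ 2 - gamma ^+ 2] =
   - ((x ^+ 2 - gamma ^+ 2) * (laguerre b k)^`()^`().[x ^+ 2 - gamma ^+ 2] +
     (b - (x ^+ 2 - gamma ^+ 2)) * (laguerre b k)^`().[x ^+ 2 - gamma ^+ 2]).
  move=> h; have /(congr1 (horner^~ (x ^+ 2 - gamma ^+ 2))) := laguerre_ode k h.
  by rewrite !hornerE => ->; rewrite mulNr opprK.
have d1 (L : {poly R}) y : (L \Po q)^`().[y] = L^`().[y ^+ 2 - gamma ^+ 2] * (y *+ 2).
  by rewrite deriv_comp dq hornerM horner_comp qE hornerMn hornerX.
have d2 (L : {poly R}) y : (L \Po q)^`()^`().[y] =
    L^`()^`().[y ^+ 2 - gamma ^+ 2] * (y *+ 2) ^+ 2 + L^`().[y ^+ 2 - gamma ^+ 2] *+ 2.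
  rewrite deriv_comp dq derivM hornerD !hornerM d1 derivMn derivX horner_comp qE.
  by rewrite !hornerMn hornerX hornerC expr2 mulrA mulr_natr.
have e1 (L : {poly R}) y : (('X - gamma%:P) * (L \Po q))^`().[y] =
    L.[y ^+ 2 - gamma ^+ 2] + (y - gamma) * (L^`().[y ^+ 2 - gamma ^+ 2] * (y *+ 2)).
  by rewrite derivM derivXsubC mul1r hornerD hornerM d1 horner_comp qE hornerXsubC.
have e2 (L : {poly R}) y : (('X - gamma%:P) * (L \Po q))^`()^`().[y] =
    L^`().[y ^+ 2 - gamma ^+ 2] * (y *+ 4) + (y - gamma) *
    (L^`()^`().[y ^+ 2 - gamma ^+ 2] * (y *+ 2) ^+ 2 + L^`().[y ^+ 2 - gamma ^+ 2] *+ 2).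
  rewrite derivM derivXsubC mul1r derivD derivM derivXsubC mul1r !hornerD hornerM.
  by rewrite d2 !d1 hornerXsubC; ring.
have reflE p : derive1 (refl (horner p)) x = - p^`().[- x].
  rewrite (_ : refl _ = horner (p \Po (- 'X))).
    by rewrite -derivE deriv_comp derivN derivX !hornerE horner_comp !hornerE mulrN1.
  by apply/funext => y; rewrite /refl horner_comp !hornerE.
rewrite /Zop derive1nS derive1n1 reflE -!derivE /refl !horner_limit_poly.
rewrite /lambda /limit_poly -/q; case: ifP => _.
  rewrite !e1 !e2 sqrrN.
  have := ode _ n./2 b10; move: (horner _ _) (horner _ _) (horner _ _) => a1 a2 a0 h.
  (* Isolates [n./2%:R * a0], which Laguerre's equation replaces; what is left is an identity in
     independent values [a0], [a1], [a2]. *)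
  have -> : (n./2%:R + eps) * ((x - gamma) * a0) =
    (x - gamma) * (n./2%:R * a0) + eps * (x - gamma) * a0 by ring.
  by rewrite h /Sx /Tx /Ux /Vx; field.
rewrite !d1 !d2 sqrrN.
have := ode _ n./2 b0; move: (horner _ _) (horner _ _) (horner _ _) => a1 a2 a0 h.
by rewrite h /Sx /Tx /Ux /Vx; field.
Qed.

End LimitPoly.

(** * Changes of variable x to -x and x to x^2 - c^2 on open rays *)

Section ChangeOfVariables.
Variable R : realType.
Notation leb := (@lebesgue_measure R).
Implicit Types (c x : R) (f : R -> R).

(** The segments [[lo c n, hi c n]] increase to the open ray beyond c without touching c; for n = 0
    the segment is the point c + 1. *)
Let lo c : R^nat := fun n => c + n.+1%:R^-1.
Let hi c : R^nat := fun n => c + n.+1%:R.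

Let lo_gt c n : c < lo c n. Proof. by rewrite /lo ltrDl invr_gt0. Qed.

Let lo_le_hi c n : lo c n <= hi c n.
Proof.
by rewrite /lo /hi lerD2l (le_trans (y := 1)) ?invf_le1 ?ler1n.
Qed.

Let lo_noninc c : nonincreasing_seq (lo c).
Proof. by move=> m n mn; rewrite lerD2l lef_pV2 ?posrE // ler_nat. Qed.

Let hi_nondec c : nondecreasing_seq (hi c).
Proof. by move=> m n mn; rewrite lerD2l ler_nat. Qed.

Let lo_hi_mem c x : c < x -> exists n, lo c n <= x <= hi c n.
Proof.
move=> cx; have xc0 : 0 < x - c by rewrite subr_gt0.
(* The sum dominates both truncations, so N + 1 exceeds both x - c and 1 / (x - c). *)
pose N := (Num.truncn (x - c) + Num.truncn (x - c)^-1)%N.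
exists N; rewrite /lo /hi; apply/andP; split.
  rewrite -lerBrDl -[leRHS]invrK lef_pV2 ?posrE ?invr_gt0 //.
  apply: ltW; apply: lt_le_trans (truncnS_gt _) _.
  by rewrite ler_nat ltnS leq_addl.
rewrite -lerBlDl; apply: ltW; apply: lt_le_trans (truncnS_gt _) _.
by rewrite ler_nat ltnS leq_addr.
Qed.

Lemma cvg_integral_ray c f : measurable_fun `]c, +oo[ f ->
  (forall x, c < x -> 0 <= f x) ->
  (\int[leb]_(x in `[(c + n.+1%:R^-1)%R, (c + n.+1%:R)%R]) (f x)%:E @[n --> \oo] -->
   \int[leb]_(x in `]c, +oo[) (f x)%:E)%E.
Proof.
move=> mf f0.
have sub n : `[lo c n, hi c n] `<=` `]c, +oo[.
  move=> x /=; rewrite !in_itv /= andbT => /andP[lx _].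
  exact: lt_le_trans (lo_gt c n) lx.
have -> : `]c, +oo[%classic = \bigcup_n `[lo c n, hi c n]%classic :> set R.
  apply/seteqP; split => x /=; last by move=> [n _]; exact: sub.
  rewrite in_itv /= andbT => /lo_hi_mem [n nx]; exists n => //=.
apply: ge0_nondecreasing_set_cvg_integral => //.
- apply/nondecreasing_seqP => n; apply/subsetPset; apply: subset_itv.
    by rewrite bnd_simp lo_noninc.
  by rewrite bnd_simp hi_nondec.
- move=> n; apply/measurable_EFinP; apply: measurable_funS mf => //; exact: (sub n).
- by move=> n x /sub /=; rewrite in_itv /= andbT lee_fin => /f0.
Qed.

Let cvgN_lo_hi c f : measurable_fun `]-oo, - c[ f ->
  (forall x, x < - c -> 0 <= f x) ->
  (\int[leb]_(x in `[(- hi c n)%R, (- lo c n)%R]) (f x)%:E @[n --> \oo] -->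
   \int[leb]_(x in `]-oo, (- c)%R[) (f x)%:E)%E.
Proof.
move=> mf f0.
have sub n : `[- hi c n, - lo c n] `<=` `]-oo, - c[.
  move=> x /=; rewrite !in_itv /= => /andP[_ lx].
  by rewrite (le_lt_trans lx) // ltrN2 lo_gt.
have -> : `]-oo, - c[%classic = \bigcup_n `[- hi c n, - lo c n]%classic :> set R.
  apply/seteqP; split => x /=; last by move=> [n _]; exact: sub.
  rewrite in_itv /= ltrNr => /lo_hi_mem [n /andP[nx xn]]; exists n => //=.
  by rewrite in_itv /= lerNl xn lerNr nx.
apply: ge0_nondecreasing_set_cvg_integral => //.
- apply/nondecreasing_seqP => n; apply/subsetPset; apply: subset_itv.
    by rewrite bnd_simp lerN2 hi_nondec.
  by rewrite bnd_simp lerN2 lo_noninc.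
- move=> n; apply/measurable_EFinP; apply: measurable_funS mf => //.
- by move=> n x /sub /=; rewrite in_itv /= lee_fin => /f0.
Qed.

Let ge0_integral_opp c f : {in `]-oo, - c[, continuous f} ->
  (forall x, x < - c -> 0 <= f x) ->
  (\int[leb]_(x in `]-oo, (- c)%R[) (f x)%:E =
   \int[leb]_(x in `]c, +oo[) (f (- x)%R)%:E)%E.
Proof.
move=> cf f0.
have cfN : {in `]c, +oo[, continuous (f \o -%R)}.
  move=> x; rewrite in_itv /= andbT => cx.
  apply: continuous_comp; first exact: opp_continuous.
  by apply: cf; rewrite in_itv /= ltrN2.
have mf : measurable_fun `]-oo, - c[ f.
  by apply: open_continuous_measurable_fun => // x /set_mem; exact: cf.
have mfN : measurable_fun `]c, +oo[ (f \o -%R).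
  by apply: open_continuous_measurable_fun => // x /set_mem; exact: cfN.
have f0N x : c < x -> 0 <= (f \o -%R) x by move=> cx; rewrite f0 // ltrN2.
have := cvgN_lo_hi mf f0.
under eq_fun => n.
  rewrite integration_by_substitution_oppr //; first over.
  apply: continuous_in_subspaceT => x /set_mem /=; rewrite in_itv /= => /andP[_ xl].
  by apply: cf; rewrite in_itv /= (le_lt_trans xl) // ltrN2 lo_gt.
move=> h1; have h2 := cvg_integral_ray mfN f0N.
by rewrite -(cvg_lim _ h1) // -(cvg_lim _ h2).
Qed.

(** The two parts are written with [Num.max] on real values, so that they are again continuous real
    functions, to which the nonnegative case applies. *)
Let integralE_EFin (D : set R) f :
  (\int[leb]_(x in D) (f x)%:E = \int[leb]_(x in D) (Num.max (f x) 0)%:E -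
   \int[leb]_(x in D) (Num.max (- f x) 0)%:E)%E.
Proof.
rewrite integralE; congr (_ - _)%E; apply: eq_integral => x _.
  by rewrite funeposE EFin_max.
by rewrite funenegE -EFinN EFin_max.
Qed.

Let continuous_max0 f x : {for x, continuous f} ->
  {for x, continuous (fun x => Num.max (f x) 0)}.
Proof.
move=> cf; apply: (@continuous_comp _ _ _ f (fun y => Num.max y 0)) => //.
by apply: (@continuous_max _ _ id (cst 0)) => //; exact: cst_continuous.
Qed.

Lemma integral_opp_ray c f : {in `]-oo, - c[, continuous f} ->
  (\int[leb]_(x in `]-oo, (- c)%R[) (f x)%:E =
   \int[leb]_(x in `]c, +oo[) (f (- x)%R)%:E)%E.
Proof.
move=> cf; rewrite integralE_EFin [RHS]integralE_EFin; congr (_ - _)%E.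
  apply: (@ge0_integral_opp c (fun x => Num.max (f x) 0)) => [x xc|x _].
    by apply: continuous_max0; exact: cf.
  by rewrite le_max lexx orbT.
apply: (@ge0_integral_opp c (fun x => Num.max (- f x) 0)) => [x xc|x _].
  by apply: (@continuous_max0 (fun x => - f x)); apply: continuousN; exact: cf.
by rewrite le_max lexx orbT.
Qed.

Let sqr_poly c : {poly R} := 'X^2 - (c ^+ 2)%:P.

Let sqr_polyE c x : (sqr_poly c).[x] = x ^+ 2 - c ^+ 2.
Proof. by rewrite /sqr_poly !hornerE. Qed.

Let sqr_poly_deriv c : derive1 (horner (sqr_poly c)) = fun x => 2 * x.
Proof.
rewrite -derivE; apply/funext => x.
by rewrite /sqr_poly derivB derivC subr0 derivXn !hornerE mulr_natl.
Qed.

(** As c >= 0, F(x) = x^2 - c^2 increases on the ray and substitution applies on each segment. The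
    image segments exhaust the positive ray, so monotone convergence on both sides identifies the
    limits. *)
Let ge0_integral_sqr c f : 0 <= c -> {in `]0, +oo[, continuous f} ->
  (forall x, 0 < x -> 0 <= f x) ->
  (\int[leb]_(x in `]c, +oo[) (f (x ^+ 2 - c ^+ 2) * (2 * x))%R%:E =
   \int[leb]_(x in `]0%R, +oo[) (f x)%:E)%E.
Proof.
move=> c0 cf f0.
pose F := horner (sqr_poly c).
have FE x : F x = x ^+ 2 - c ^+ 2 by rewrite /F sqr_polyE.
have F0 x : c < x -> 0 < F x.
  by move=> cx; rewrite FE subr_gt0 ltr_pXn2r // nnegrE // ltW // (le_lt_trans c0).
have Fincr : {in `]c, +oo[ &, {homo F : x y / x < y}}.
  move=> x y; rewrite !in_itv /= !andbT !FE => cx cy xy.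
  by rewrite ltrD2r ltr_pXn2r // nnegrE ltW // (le_lt_trans c0).
have cF : continuous F by exact: continuous_horner.
pose g x := f (x ^+ 2 - c ^+ 2) * (2 * x).
have cg : {in `]c, +oo[, continuous g}.
  move=> x; rewrite in_itv /= andbT => cx.
  have -> : g = (f \o F) * (fun x => 2 * x).
    by apply/funext => y; rewrite /g fctE /= FE.
  apply: continuousM.
    by apply: continuous_comp; [exact: cF|apply: cf; rewrite in_itv /= F0].
  by apply: continuousM; [exact: cst_continuous|exact: cvg_id].
have mg : measurable_fun `]c, +oo[ g.
  by apply: open_continuous_measurable_fun => // x /set_mem; exact: cg.
have g0 x : c < x -> 0 <= g x.
  by move=> cx; rewrite mulr_ge0 ?f0 -?FE ?F0 // mulr_ge0 // ltW // (le_lt_trans c0).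
have mf : measurable_fun `]0 : R, +oo[ f.
  by apply: open_continuous_measurable_fun => // x /set_mem; exact: cf.
have := cvg_integral_ray mg g0.
have c2 : continuous (fun x : R => 2 * x).
  exact: mulrl_continuous.
have ext n : (\int[leb]_(x in `[lo c n, hi c n]) (g x)%:E =
              \int[leb]_(x in `[F (lo c n), F (hi c n)]) (f x)%:E)%E.
  have sub x : x \in `[lo c n, hi c n] -> c < x.
    by rewrite in_itv /= => /andP[lx _]; exact: lt_le_trans (lo_gt c n) lx.
  rewrite (@integration_by_substitution_increasing _ F f) //.
  - apply: eq_integral => x _; rewrite /F sqr_poly_deriv /g !fctE /=.
    by rewrite sqr_polyE.
  - move=> x y /sub cx /sub cy; apply: Fincr; rewrite in_itv /= ?cx ?cy //.
  - rewrite /F sqr_poly_deriv => x _; exact: c2.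
  - rewrite /F sqr_poly_deriv; apply: (@cvgP _ _ (2 * lo c n)).
    exact: (cvg_at_right_filter (c2 _)).
  - rewrite /F sqr_poly_deriv; apply: (@cvgP _ _ (2 * hi c n)).
    exact: (cvg_at_left_filter (c2 _)).
  - split.
    + by move=> x _; exact: derivable_horner.
    + by apply: cvg_at_right_filter; exact: cF.
    + by apply: cvg_at_left_filter; exact: cF.
  - apply: continuous_in_subspaceT => x /set_mem /=; rewrite in_itv /= => /andP[lx _].
    by apply: cf; rewrite in_itv /= andbT (lt_le_trans _ lx) // F0.
under eq_fun do rewrite ext.
move=> h1; rewrite -(cvg_lim _ h1) //; apply: cvg_lim => //.
have -> : `]0, +oo[%classic = \bigcup_n `[F (lo c n), F (hi c n)]%classic :> set R.
  apply/seteqP; split => x /=; last first.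
    move=> [n _] /=; rewrite !in_itv /= andbT => /andP[lx _].
    by rewrite (lt_le_trans _ lx) // F0.
  rewrite in_itv /= andbT => x0.
  (* This square root is the preimage of x under F; a segment containing it has an image containing
     x. *)
  have cs : c < Num.sqrt (x + c ^+ 2).
    rewrite -{1}(ger0_norm c0) -sqrtr_sqr ltr_sqrt ?ltrDr //.
    by rewrite ltr_pwDl // sqr_ge0.
  have [n /andP[l1 l2]] := lo_hi_mem cs; exists n => //=.
  have s0 : 0 <= Num.sqrt (x + c ^+ 2) by exact: sqrtr_ge0.
  have sq : F (Num.sqrt (x + c ^+ 2)) = x.
    by rewrite FE sqr_sqrtr ?addrK // addr_ge0 ?sqr_ge0 // ltW.
  have cpos k : 0 <= lo c k by apply: le_trans c0 _; exact/ltW/lo_gt.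
  rewrite in_itv /= -{1 2}sq !FE !lerD2r !ler_pXn2r ?nnegrE ?l1 ?l2 ?cpos //.
  exact: le_trans (cpos n) (lo_le_hi c n).
have Flo n : 0 < F (lo c n) by rewrite F0.
have cpos k : 0 <= lo c k by apply: le_trans c0 _; exact/ltW/lo_gt.
apply: ge0_nondecreasing_set_cvg_integral => //.
- apply/nondecreasing_seqP => n; apply/subsetPset; apply: subset_itv; rewrite bnd_simp !FE lerD2r.
    by rewrite ler_pXn2r ?nnegrE ?cpos // lo_noninc.
  by rewrite ler_pXn2r ?nnegrE ?hi_nondec //; apply: le_trans (lo_le_hi _ _).
- move=> n; apply/measurable_EFinP; apply: measurable_funS mf => //.
  by move=> x /=; rewrite !in_itv /= andbT => /andP[lx _]; exact: lt_le_trans lx.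
- move=> n x /=; rewrite in_itv /= => /andP[lx _]; rewrite lee_fin f0 //.
  exact: lt_le_trans lx.
Qed.

Lemma integral_sqr_ray c f : 0 <= c -> {in `]0, +oo[, continuous f} ->
  (\int[leb]_(x in `]c, +oo[) (f (x ^+ 2 - c ^+ 2) * (2 * x))%R%:E =
   \int[leb]_(x in `]0%R, +oo[) (f x)%:E)%E.
Proof.
move=> c0 cf; rewrite [LHS]integralE_EFin [RHS]integralE_EFin; congr (_ - _)%E.
  rewrite -(ge0_integral_sqr c0); last 2 first.
  - by move=> x xc; apply: continuous_max0; exact: cf.
  - by move=> x _; rewrite le_max lexx orbT.
  (* The Jacobian 2x is nonnegative on the ray, so it can be taken out of the maximum. *)
  apply: eq_integral => x; rewrite inE /= in_itv /= andbT => cx.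
  rewrite maxr_pMl ?mul0r // mulr_ge0 // ltW //; exact: le_lt_trans cx.
rewrite -(@ge0_integral_sqr c (fun x => Num.max (- f x) 0) c0); last 2 first.
- by move=> x xc; apply: (@continuous_max0 (fun x => - f x)); apply: continuousN; exact: cf.
- by move=> x _; rewrite le_max lexx orbT.
apply: eq_integral => x; rewrite inE /= in_itv /= andbT => cx.
rewrite -mulNr maxr_pMl ?mul0r // mulr_ge0 // ltW //; exact: le_lt_trans cx.
Qed.

End ChangeOfVariables.

(** * Euler's integral: functional equation, finiteness and polynomial moments *)

Section GammaIntegral.
Variable R : realType.
Notation leb := (@lebesgue_measure R).
Implicit Types (a b t x : R) (p : {poly R}).

Definition gamma_density a t : R := t `^ (a - 1) * expR (- t).

Lemma gamma_density_ge0 a t : 0 <= gamma_density a t.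
Proof. by rewrite mulr_ge0 ?powR_ge0 ?expR_ge0. Qed.

Let continuous_expRN : continuous (fun t : R => expR (- t)).
Proof.
move=> t; apply: (@continuous_comp _ _ _ -%R expR).
  exact: opp_continuous.
exact: continuous_expR.
Qed.

Let continuous_powR_pos a t : 0 < t -> {for t, continuous (@powR R ^~ a)}.
Proof.
move=> t0; apply: differentiable_continuous; apply/derivable1_diffP.
by apply: derivable_powR; rewrite in_itv /= t0.
Qed.

Lemma continuous_gamma_density a t : 0 < t ->
  {for t, continuous (gamma_density a)}.
Proof.
move=> t0; apply: continuousM; last exact: continuous_expRN.
exact: continuous_powR_pos.
Qed.

Lemma measurable_gamma_density a : measurable_fun `]0 : R, +oo[ (gamma_density a).
Proof.
apply: open_continuous_measurable_fun => // t /set_mem /=.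
by rewrite in_itv /= andbT; exact: continuous_gamma_density.
Qed.

Lemma powR_expRN_cvg0 a : n.+1%:R `^ a * expR (- n.+1%:R) @[n --> \oo] --> (0 : R).
Proof.
(* Since k > a, the number m = n + 1 satisfies m^a m <= m^(k+1) <= (k+1)! e^m, which gives the bound
   (k+1)! / m. *)
pose k := (Num.truncn a).+1.
apply: (@squeeze_cvgr _ _ _ _ (cst 0) (fun n => k.+1`!%:R * @harmonic R n)).
- near=> n; rewrite mulr_ge0 ?powR_ge0 ?expR_ge0 //=.
  rewrite expRN ler_pdivrMr ?expR_gt0 // mulrAC ler_pdivlMr //.
  apply: (@le_trans _ _ (n.+1%:R ^+ k.+1)).
    rewrite exprSr ler_wpM2r // -powR_mulrn // ler_powR ?ler1n //.
    by apply: ltW; exact: truncnS_gt.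
  have := @expR_ge1Dxn R n.+1%:R k (ler0n _ _).
  move=> h; rewrite mulrC -ler_pdivrMr ?ltr0n ?fact_gt0 //.
  by apply: le_trans h; rewrite lerDr.
- exact: cvg_cst.
- rewrite -[X in _ --> X](mulr0 k.+1`!%:R).
  by apply: cvgM; [exact: cvg_cst|exact: cvg_harmonic].
Unshelve. all: by end_near. Qed.

Lemma powR_harmonic_cvg0 a : 0 < a -> (n.+1%:R^-1 : R) `^ a @[n --> \oo] --> (0 : R).
Proof.
move=> a0; have /cvg_at_rightP := powR_cvg0 a0.
move=> /(_ (@harmonic R)); apply; split.
  by move=> n; rewrite /= invr_gt0.
exact: cvg_harmonic.
Qed.

Notation gamma_int a :=
  (\int[leb]_(t in `]0%R, +oo[) (gamma_density a t)%:E)%E.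

(** Integration by parts with t^a and -e^(-t) on the segments: the boundary term [r] tends to 0, at
    the left end because a > 0, at the right end by exponential decay. *)
Lemma gamma_int_succ a : 0 < a -> gamma_int (a + 1) = (a%:E * gamma_int a)%E.
Proof.
move=> a0.
pose lo n : R := 0 + n.+1%:R^-1; pose hi n : R := 0 + n.+1%:R.
pose I b n := (\int[leb]_(t in `[lo n, hi n]) (gamma_density b t)%:E)%E.
have cI b : (I b n @[n --> \oo] --> gamma_int b)%E.
  apply: cvg_integral_ray; first exact: measurable_gamma_density.
  by move=> x _; exact: gamma_density_ge0.
pose r n : R := lo n `^ a * expR (- lo n) - hi n `^ a * expR (- hi n).
have cr : r n @[n --> \oo] --> (0 : R).
  rewrite -[X in _ --> X](subr0 0); apply: cvgB; last first.
    rewrite /hi; under eq_fun do rewrite add0r.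
    exact: powR_expRN_cvg0.
  have -> : lo = @harmonic R by apply/funext => n; rewrite /lo add0r.
  rewrite -[X in _ --> X](mul0r (expR (- 0))).
  apply: cvgM; first exact: powR_harmonic_cvg0.
  apply: (@cvg_comp _ _ _ (@harmonic R) (fun t : R => expR (- t)) _ (nbhs (0 : R)) _ cvg_harmonic).
  exact: continuous_expRN.
have pos n t : t \in `[lo n, hi n] -> 0 < t.
  rewrite in_itv /= => /andP[h _]; apply: lt_le_trans h.
  by rewrite /lo add0r invr_gt0.
(* For n = 0 the segment is a single point, while integration by parts is applied with
   [lo n < hi n]. *)
have E n : (0 < n)%N -> (I (a + 1)%R n = (r n)%:E + a%:E * I a n)%E.
  move=> n0; have ab : lo n < hi n.
    rewrite /lo /hi !add0r (@lt_trans _ _ 1) ?invf_lt1 ?ltr1n //.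
  have loin : 0 < lo n by rewrite /lo add0r invr_gt0.
  have hiin : 0 < hi n by exact: lt_trans ab.
  have cgd : {within `[lo n, hi n], continuous (gamma_density a)}.
    apply: continuous_in_subspaceT => t /set_mem /= /pos t0.
    exact: continuous_gamma_density.
  have := @integration_by_parts R (@powR R ^~ a) (fun t => - expR (- t))
    (fun t => a * t `^ (a - 1)) (fun t => expR (- t)) (lo n) (hi n) ab.
  have -> : (\int[leb]_(t in `[lo n, hi n]) (t `^ a * expR (- t)%R)%:E = I (a + 1)%R n)%E.
    by apply: eq_integral => t _; rewrite /gamma_density addrK.
  move=> ->.
  - rewrite (_ : hi n `^ a * - _ - _ = r n); last by rewrite /r; ring.
    congr (_ + _)%E.
    under eq_integral => t _.
      rewrite (_ : _ * _ = - a * gamma_density a t); last by rewrite /gamma_density; ring.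
      rewrite EFinM; over.
    rewrite integralZl //; last first.
      by apply: continuous_compact_integrable => //; exact: segment_compact.
    by rewrite EFinN mulNe oppeK.
  - apply: continuous_in_subspaceT => t /set_mem /= /pos t0.
    by apply: cvgM; [exact: cvg_cst|exact: continuous_powR_pos].
  - split.
    + move=> t tin; apply: derivable_powR; rewrite in_itv /= andbT.
      by apply: (pos n); exact: subset_itv_oo_cc tin.
    + by apply: cvg_at_right_filter; exact: continuous_powR_pos.
    + by apply: cvg_at_left_filter; exact: continuous_powR_pos.
  - move=> t tin; rewrite powR_derive1 // in_itv /= andbT.
    by apply: (pos n); exact: subset_itv_oo_cc tin.
  - by apply: continuous_subspaceT; exact: continuous_expRN.
  - split.
    + by move=> t _; exact: ex_derive.
    + by apply: cvgN; apply: cvg_at_right_filter; exact: continuous_expRN.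
    + by apply: cvgN; apply: cvg_at_left_filter; exact: continuous_expRN.
  - move=> t _; rewrite derive1E derive_val; ring.
have h : ((r n)%:E + a%:E * I a n @[n --> \oo] --> 0%:E + a%:E * gamma_int a)%E.
  apply: cvgeD; first by rewrite fin_num_adde_defr.
    by apply: cvg_EFin; [exact: nearW|exact: cr].
  by apply: cvgeZl.
rewrite add0e in h; rewrite -(cvg_lim _ h) //; apply/esym/cvg_lim => //.
apply: cvg_trans (cI (a + 1)); apply: near_eq_cvg.
by exists 1%N => // n /= n1; rewrite E.
Qed.

Lemma gamma_int1_lty : (gamma_int 1 < +oo)%E.
Proof.
rewrite integral_itv_obnd_cbnd; last first.
  by apply/measurable_EFinP; exact: measurable_gamma_density.
under eq_integral do rewrite /gamma_density subrr powRr0 mul1r.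
have := @ge0_continuous_FTC2y R (fun t => expR (- t)) (fun t => - expR (- t)) 0 0.
move=> ->.
- by rewrite -EFinB ltry.
- by move=> x _; exact: expR_ge0.
- by apply: continuous_subspaceT; exact: continuous_expRN.
- by rewrite -[X in _ --> X]oppr0; apply: cvgN; exact: cvgr_expR.
- by move=> x _; exact: ex_derive.
- by apply: cvgN; apply: cvg_at_right_filter; exact: continuous_expRN.
- by move=> x _; rewrite derive1E derive_val; ring.
Qed.

(* The recurrence, valid in the extended reals, gives finiteness at the positive
   integers, and turns finiteness at [a + 1] into finiteness at [a]. *)
Lemma gamma_int_lty a : 0 < a -> (gamma_int a < +oo)%E.
Proof.
move=> a0.
have nat_lty k : (gamma_int k.+1%:R < +oo)%E.
  elim: k => [|k IHk]; first exact: gamma_int1_lty.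
  by rewrite -natr1 gamma_int_succ // lte_mul_pinfty // lee_fin.
pose k := (Num.truncn a).+1.
have : (gamma_int (a + 1) < +oo)%E.
  (* The power t^a is at most 1 for t <= 1 and at most t^k for t > 1, because k > a > 0. *)
  apply: (@le_lt_trans _ _ (gamma_int 1 + gamma_int k.+1%:R)%E); last first.
    by apply: lte_add_pinfty; [exact: gamma_int1_lty|exact: nat_lty].
  rewrite -ge0_integralD //; first last.
  - by apply/measurable_EFinP; exact: measurable_gamma_density.
  - by move=> t _; rewrite lee_fin gamma_density_ge0.
  - by apply/measurable_EFinP; exact: measurable_gamma_density.
  - by move=> t _; rewrite lee_fin gamma_density_ge0.
  apply: ge0_le_integral => //.
  - by move=> t _; rewrite lee_fin gamma_density_ge0.
  - by apply/measurable_EFinP; exact: measurable_gamma_density.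
  - apply: emeasurable_funD; apply/measurable_EFinP; exact: measurable_gamma_density.
  move=> t /=; rewrite in_itv /= andbT => t0.
  rewrite -EFinD lee_fin /gamma_density -mulrDl ler_wpM2r ?expR_ge0 //.
  rewrite addrK subrr powRr0 -natr1 addrK.
  have [t1|t1] := leP t 1.
    rewrite (@le_trans _ _ 1) ?lerDl ?powR_ge0 //.
    by rewrite -(powRr0 t) ger_powR ?t0 // ltW.
  rewrite (@le_trans _ _ (t `^ k%:R)) ?lerDr //.
  rewrite ler_powR // ltW //; exact: truncnS_gt.
rewrite gamma_int_succ //.
apply: contraTT; rewrite -!leNgt !leye_eq => /eqP ->.
by rewrite gt0_muley ?lte_fin.
Qed.

Lemma integrable_gamma_density a : 0 < a ->
  leb.-integrable `]0 : R, +oo[ (EFin \o gamma_density a).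
Proof.
move=> a0; apply/integrableP; split.
  by apply/measurable_EFinP; exact: measurable_gamma_density.
under eq_integral do rewrite /= ger0_norm ?gamma_density_ge0 //.
exact: gamma_int_lty.
Qed.

(** [Gamma] is the [fine] of the extended integral and would be 0 if that were infinite; finiteness
    makes the two agree. *)
Lemma gamma_intE a : 0 < a -> gamma_int a = (Gamma a)%:E.
Proof.
move=> a0; rewrite /Gamma /Rintegral fineK //.
by apply: integrable_fin_num; [exact: measurable_itv|exact: integrable_gamma_density].
Qed.

Lemma Gamma_succ a : 0 < a -> Gamma (a + 1) = a * Gamma a.
Proof.
move=> a0; apply: EFin_inj; rewrite EFinM -!gamma_intE ?addr_gt0 //.
exact: gamma_int_succ.
Qed.

Lemma Gamma_poch a k : 0 < a -> Gamma (a + k%:R) = Gamma a * poch a k.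
Proof.
move=> a0; elim: k => [|k IHk]; first by rewrite addr0 poch0 mulr1.
by rewrite -natr1 addrA Gamma_succ ?ltr_wpDr // IHk pochS; ring.
Qed.

(** Integrability and value are proved together, since additivity of the integral asks for
    integrable summands. Linearity reduces both to monomials, where t^k shifts the parameter to b +
    k. *)
Lemma poly_gamma_density b p : 0 < b ->
  leb.-integrable `]0 : R, +oo[ (fun t => (p.[t] * gamma_density b t)%:E) /\
  (\int[leb]_(t in `]0%R, +oo[) (p.[t] * gamma_density b t)%:E =
   (Gamma b * moment b p)%:E)%E.
Proof.
move=> b0.
pose P p := leb.-integrable `]0 : R, +oo[ (fun t => (p.[t] * gamma_density b t)%:E) /\
  (\int[leb]_(t in `]0%R, +oo[) (p.[t] * gamma_density b t)%:E =
   (Gamma b * moment b p)%:E)%E.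
have PZ c q : P q -> P (c *: q).
  move=> [iq eq]; have ext t : ((c *: q).[t] * gamma_density b t)%:E =
     (c%:E * (q.[t] * gamma_density b t)%:E)%E by rewrite hornerZ -mulrA EFinM.
  split; first by rewrite (eq_fun ext); exact: integrableZl.
  under eq_integral do rewrite ext.
  by rewrite integralZl // eq -EFinM linearZ /=; congr _%:E; ring.
have PD q1 q2 : P q1 -> P q2 -> P (q1 + q2).
  move=> [i1 e1] [i2 e2].
  have ext t : ((q1 + q2).[t] * gamma_density b t)%:E =
     ((q1.[t] * gamma_density b t)%:E + (q2.[t] * gamma_density b t)%:E)%E.
    by rewrite hornerD mulrDl EFinD.
  split; first by rewrite (eq_fun ext); exact: integrableD.
  under eq_integral do rewrite ext.
  by rewrite integralD // e1 e2 -EFinD linearD /= mulrDr.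
have PX k : P 'X^k.
  have bk0 : 0 < b + k%:R by rewrite ltr_wpDr.
  have ext t : t \in (`]0, +oo[%classic : set R) -> (('X^k).[t] * gamma_density b t)%:E =
     (gamma_density (b + k%:R) t)%:E.
    rewrite inE /= in_itv /= andbT => t0; rewrite hornerXn /gamma_density mulrA.
    rewrite -powR_mulrn ?(ltW t0) // -powRD ?(gt_eqF t0) ?implybT //.
    by congr (_ `^ _ * _)%:E; ring.
  split.
    apply: eq_integrable (integrable_gamma_density bk0) => // t tin /=.
    by rewrite ext.
  rewrite momentXn -Gamma_poch // -gamma_intE //.
  by apply: eq_integral => t tin; rewrite ext.
rewrite -[p]coefK poly_def; apply: (big_ind P) => [|//|k _]; last exact/PZ/PX.
by rewrite -(scale0r 'X^0); exact/PZ/PX.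
Qed.

End GammaIntegral.

(** * Folding the weighted integral over the two rays, and orthogonality *)

Section Orthogonality.
Variables (R : realType) (mu gamma : R).
Hypothesis hmu : - (1 / 2) < mu.
Notation leb := (@lebesgue_measure R).
Implicit Types (x t : R) (p q : {poly R}).

Let b : R := mu + 1 / 2.

Let b0 : 0 < b. Proof. by rewrite /b -(opprK (1 / 2)) subr_gt0. Qed.

Let c : R := `|gamma|.

Let c0 : 0 <= c. Proof. exact: normr_ge0. Qed.

Let c2 : c ^+ 2 = gamma ^+ 2. Proof. by rewrite /c real_normK ?num_real. Qed.

Let u x : R := gamma_density b (x ^+ 2 - gamma ^+ 2).

Let ray_sqr_gt0 x : c < x -> 0 < x ^+ 2 - gamma ^+ 2.
Proof.
by move=> cx; rewrite -c2 subr_gt0 ltr_pXn2r // nnegrE // ltW // (le_lt_trans c0).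
Qed.

(** The splitting e^(-x^2) = e^(-t) e^(-gamma^2) is the origin of the exponential factor in
    [norm_const]. *)
Let weight_density x : (x ^+ 2 - gamma ^+ 2) `^ (mu - 1 / 2) * expR (- x ^+ 2) =
  u x * expR (- gamma ^+ 2).
Proof.
rewrite /u /gamma_density -mulrA -expRD; congr (_ `^ _ * expR _); last by ring.
by rewrite /b; field.
Qed.

Let weight_right x : c < x ->
  weight mu gamma x = (x + gamma) * u x * expR (- gamma ^+ 2).
Proof.
move=> cx; rewrite /weight -mulrA weight_density gtr0_sg ?(le_lt_trans c0) //.
by rewrite mul1r mulrA.
Qed.

Let weight_left x : c < x ->
  weight mu gamma (- x) = (x - gamma) * u x * expR (- gamma ^+ 2).
Proof.
move=> cx; rewrite /weight sqrrN -mulrA weight_density sgrN gtr0_sg ?(le_lt_trans c0) //.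
by ring.
Qed.

Let continuous_ray p x : c < x -> {for x, continuous (fun x => p.[x] * u x)}.
Proof.
move=> cx; apply: continuousM; first exact: continuous_horner.
apply: (@continuous_comp _ _ _ (fun x => x ^+ 2 - gamma ^+ 2) (gamma_density b)).
  rewrite (_ : (fun _ => _) = horner ('X^2 - (gamma ^+ 2)%:P)).
    exact: continuous_horner.
  by apply/funext => y; rewrite !hornerE.
by apply: continuous_gamma_density; exact: ray_sqr_gt0.
Qed.

(** Odd powers of x are also bounded in terms of t alone, because t + 1 + gamma^2 = 1 + x^2 >=
    |x|. *)
Let poly_bound p : exists q, forall x, `|p.[x]| <= q.[x ^+ 2 - gamma ^+ 2].
Proof.
exists (\sum_(k < size p) `|p`_k| *: ('X + (1 + gamma ^+ 2)%:P) ^+ k) => x.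
rewrite horner_coef horner_sum; apply: le_trans (ler_norm_sum _ _ _) _.
apply: ler_sum => k _; rewrite normrM normrX hornerZ horner_exp hornerD.
rewrite hornerX hornerC ler_wpM2l //.
rewrite (_ : _ - _ + (1 + _) = 1 + `|x| ^+ 2); last by rewrite real_normK ?num_real //; ring.
rewrite lerXn2r ?nnegrE ?addr_ge0 ?sqr_ge0 //.
have := sqr_ge0 (`|x| - 1); nra.
Qed.

(** Used with d = gamma and d = -gamma. The integrand need not be 2x times a function of t, but it
    is dominated by one: |p(x)| <= |q(t)| by [poly_bound], and |x + d| <= x + c <= 2x on the ray. *)
Let integrable_ray p d : `|d| = c ->
  leb.-integrable `]c, +oo[ (fun x => (p.[x] * (x + d) * u x)%:E).
Proof.
move=> dc; have [q pq] := poly_bound p.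
have Fq t : 0 < t -> {for t, continuous (fun t => `|q.[t]| * gamma_density b t)}.
  move=> t0; apply: continuousM; last exact: continuous_gamma_density.
  apply: (@continuous_comp _ _ _ (horner q) (@Num.norm _ R)).
    exact: continuous_horner.
  exact: norm_continuous.
have mray (f : R -> R) : (forall x, c < x -> {for x, continuous f}) ->
    measurable_fun (`]c, +oo[%classic : set R) (EFin \o f).
  move=> cf; apply/measurable_EFinP; apply: open_continuous_measurable_fun => //.
  by move=> x /set_mem /=; rewrite in_itv /= andbT; exact: cf.
pose g x := `|q.[x ^+ 2 - c ^+ 2]| * gamma_density b (x ^+ 2 - c ^+ 2) * (2 * x).
have g0 x : c < x -> 0 <= g x.
  move=> cx; rewrite /g; apply: mulr_ge0.
    by apply: mulr_ge0 => //; exact: gamma_density_ge0.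
  by rewrite mulr_ge0 // ltW // (le_lt_trans c0).
have ig : leb.-integrable `]c, +oo[ (EFin \o g).
  apply/integrableP; split.
    apply: mray => x cx; rewrite /g.
    have -> : (fun x => `|q.[x ^+ 2 - c ^+ 2]| * gamma_density b (x ^+ 2 - c ^+ 2) * (2 * x)) =
       (fun x => `|(q \Po ('X^2 - (gamma ^+ 2)%:P)).[x]|) \* (fun x => (2 *: 'X).[x] * u x).
      apply/funext => y /=; rewrite /u c2 horner_comp hornerZ hornerX.
      by rewrite hornerD hornerXn hornerN hornerC; ring.
    apply: continuousM; last exact: continuous_ray.
    apply: (@continuous_comp _ _ _ (horner (q \Po ('X^2 - (gamma ^+ 2)%:P))) (@Num.norm _ R)).
      exact: continuous_horner.
    exact: norm_continuous.
  have -> : (\int[leb]_(x in `]c, +oo[) `|(EFin \o g) x| =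
             \int[leb]_(x in `]c, +oo[) (g x)%:E)%E.
    apply: eq_integral => x; rewrite inE /= in_itv /= andbT => cx.
    by rewrite /= ger0_norm // g0.
  rewrite (@integral_sqr_ray _ c (fun t => `|q.[t]| * gamma_density b t)) //; last first.
    by move=> t; rewrite in_itv /= andbT; exact: Fq.
  have [/integrableP[mq iq] _] := poly_gamma_density q b0.
  apply: le_lt_trans iq; apply: ge0_le_integral => //.
  - by move=> t _; rewrite lee_fin mulr_ge0 // gamma_density_ge0.
  - apply/measurable_EFinP; apply: open_continuous_measurable_fun => //.
    by move=> t /set_mem /=; rewrite in_itv /= andbT; exact: Fq.
  - exact: (measurableT_comp (@abse_measurable R _) mq).
  move=> t _; rewrite lee_fin normrM (ger0_norm (gamma_density_ge0 _ _)) //.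
apply: le_integrable ig => //.
  have -> : (fun x => (p.[x] * (x + d) * u x)%:E) =
      EFin \o (fun x => (p * ('X + d%:P)).[x] * u x).
    by apply/funext => x /=; rewrite !hornerE.
  by apply: mray => x; exact: continuous_ray.
move=> x /=; rewrite in_itv /= andbT => cx.
have x0 : 0 < x by exact: le_lt_trans cx.
rewrite lee_fin (ger0_norm (g0 _ cx)) /g /u c2 normrM.
rewrite (ger0_norm (gamma_density_ge0 _ _)) normrM mulrAC.
apply: ler_pM.
- by apply: mulr_ge0; [exact: normr_ge0|exact: gamma_density_ge0].
- exact: normr_ge0.
- rewrite ler_wpM2r ?gamma_density_ge0 //.
  exact: le_trans (pq x) (ler_norm _).
rewrite (le_trans (ler_normD _ _)) // dc (gtr0_norm x0).
by rewrite mulr2n mulrDl mul1r lerD2l ltW.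
Qed.

(** Without the null set of endpoints the support is a disjoint union of open rays, even for gamma =
    0, when the closed rays meet at 0. *)
Let support_setE :
  support_set gamma `\ c `\ - c = `]-oo, - c[ `|` `]c, +oo[.
Proof.
rewrite /support_set -/c; apply/seteqP; split => x /=; rewrite !in_itv /= !andbT.
  move=> [[[xc|cx] /eqP xNc] /eqP xNNc].
    by left; rewrite lt_neqAle xNNc.
  by right; rewrite lt_neqAle eq_sym xNc.
move=> [xc|cx]; split; [split| |split|].
- by left; exact: ltW.
- by move=> xE; move: xc; rewrite xE ltNge (le_trans _ c0) ?oppr_le0.
- by move=> xE; move: xc; rewrite xE ltxx.
- by right; exact: ltW.
- by move=> xE; move: cx; rewrite xE ltxx.
- by move=> xE; move: cx; rewrite xE ltNge (le_trans _ c0) ?oppr_le0.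
Qed.

Let integral_support (f : R -> \bar R) :
  measurable_fun `]-oo, - c[ f -> measurable_fun `]c, +oo[ f ->
  measurable_fun (support_set gamma) f /\
  (\int[leb]_(x in support_set gamma) f x =
   \int[leb]_(x in `]-oo, (- c)%R[) f x + \int[leb]_(x in `]c, +oo[) f x)%E.
Proof.
move=> m1 m2.
have mU : measurable_fun (`]-oo, - c[ `|` `]c, +oo[) f.
  by apply/measurable_funU.
have mS : measurable (support_set gamma).
  by rewrite /support_set; exact: measurableU.
have mSc : measurable (support_set gamma `\ c).
  exact: measurableD.
have mfc : measurable_fun (support_set gamma `\ c) f.
  apply: (@measurable_funS _ _ _ _ ((`]-oo, - c[ `|` `]c, +oo[) `|` [set - c])).
  - by apply: measurableU => //; exact: measurableU.
  - rewrite -support_setE => x Sx /=; have [->|/eqP xc] := eqVneq x (- c).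
      by right.
    by left.
  apply/measurable_funU => //; first exact: measurableU.
  by split => //; exact: measurable_fun_set1.
have mf : measurable_fun (support_set gamma) f.
  apply: (@measurable_funS _ _ _ _ ((support_set gamma `\ c) `|` [set c])).
  - exact: measurableU.
  - move=> x Sx /=; have [->|/eqP xc] := eqVneq x c; first by right.
    by left.
  apply/measurable_funU => //.
  by split => //; exact: measurable_fun_set1.
split=> //.
rewrite -(@integral_setD1 _ f c) // -(@integral_setD1 _ f (- c)); last 2 first.
- by rewrite support_setE; exact: measurableU.
- by rewrite support_setE.
rewrite support_setE integral_setU //.
rewrite disj_set2E; apply/eqP/seteqP; split => // x [] /=.
rewrite !in_itv /= andbT => xc cx.
have := lt_trans cx xc; rewrite ltNge (le_trans _ c0) ?oppr_le0 //.
Qed.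

(** The hypothesis is the folding: by [weight_right] and [weight_left], its two summands are the
    contributions of x and -x, up to the common factor [u x] and the constant e^(-gamma^2). *)
Lemma integral_poly_weight p q :
  (forall x, p.[x] * (x + gamma) + p.[- x] * (x - gamma) =
             2 * x * q.[x ^+ 2 - gamma ^+ 2]) ->
  leb.-integrable (support_set gamma) (fun x => (p.[x] * weight mu gamma x)%:E) /\
  (\int[leb]_(x in support_set gamma) (p.[x] * weight mu gamma x)%:E =
   (expR (- gamma ^+ 2) * (Gamma b * moment b q))%:E)%E.
Proof.
move=> pq; pose H x := p.[x] * weight mu gamma x.
set e := expR (- gamma ^+ 2).
have Hr x : c < x -> H x = e * (p.[x] * (x + gamma) * u x).
  by move=> cx; rewrite /H weight_right // /e; ring.
have Hl x : c < x -> H (- x) = e * (p.[- x] * (x - gamma) * u x).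
  by move=> cx; rewrite /H weight_left // /e; ring.
have ir : leb.-integrable `]c, +oo[ (EFin \o H).
  have iZ : leb.-integrable `]c, +oo[
      (fun x => (e%:E * (p.[x] * (x + gamma) * u x)%:E)%E).
    by apply: integrableZl => //; exact: integrable_ray.
  apply: eq_integrable iZ => // x.
  by rewrite inE /= in_itv /= andbT => cx; rewrite Hr.
have il : leb.-integrable `]c, +oo[ (fun x => (H (- x))%:E).
  have iZ : leb.-integrable `]c, +oo[
      (fun x => (e%:E * ((p \Po - 'X).[x] * (x + - gamma) * u x)%:E)%E).
    by apply: integrableZl => //; apply: integrable_ray; rewrite normrN.
  apply: eq_integrable iZ => // x; rewrite inE /= in_itv /= andbT => cx.
  by rewrite Hl // horner_comp hornerN hornerX.
(* [H] involves the sign of x, so its continuity at x is read off from [Hl], which gives H (- y) by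
   a continuous expression for all y near - x. *)
have cl : {in `]-oo, - c[, continuous H}.
  move=> x; rewrite in_itv /= ltrNr => cx.
  have E : H = (fun x => H (- x)) \o -%R by apply/funext => y; rewrite /= opprK.
  rewrite E; apply: continuous_comp; first exact: opp_continuous.
  have cK : {for - x, continuous (fun y => e * ((p \Po - 'X) * ('X - gamma%:P)).[y] * u y)}.
    have -> : (fun y => e * ((p \Po - 'X) * ('X - gamma%:P)).[y] * u y) =
              (fun y => (e *: ((p \Po - 'X) * ('X - gamma%:P))).[y] * u y).
      by apply/funext => y; rewrite hornerZ.
    exact: continuous_ray.
  apply: cvg_trans; last first.
    rewrite (_ : H (- - x) = e * ((p \Po - 'X) * ('X - gamma%:P)).[- x] * u (- x)); first exact: cK.
    by rewrite Hl // hornerM horner_comp hornerN hornerXsubC hornerX -!mulrA.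
  apply: near_eq_cvg; near=> y.
  have cy : c < y by near: y; exact: lt_nbhsr.
  by rewrite Hl // hornerM horner_comp hornerN hornerXsubC hornerX -!mulrA.
have ml : measurable_fun `]-oo, - c[ (EFin \o H).
  apply/measurable_EFinP; apply: open_continuous_measurable_fun => //.
  by move=> x /set_mem; exact: cl.
have mr : measurable_fun `]c, +oo[ (EFin \o H) by case/integrableP: ir.
have cla : {in `]-oo, - c[, continuous (fun x => `|H x|)}.
  move=> x xc; apply: (@continuous_comp _ _ _ H (@Num.norm _ R)).
    exact: cl.
  exact: norm_continuous.
have [mS iS] := integral_support ml mr.
split.
  apply/integrableP; split => //.
  have [_ ->] := @integral_support (fun x => `|(H x)%:E|)%E
    (measurableT_comp (@abse_measurable R _) ml) (measurableT_comp (@abse_measurable R _) mr).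
  rewrite (@integral_opp_ray _ c (fun x => `|H x|) cla).
  by apply: lte_add_pinfty; [case/integrableP: il|case/integrableP: ir].
rewrite iS (integral_opp_ray cl) -integralD //.
transitivity (\int[leb]_(x in `]c, +oo[) (e * (q.[(x ^+ 2 - c ^+ 2)%R] *
    gamma_density b (x ^+ 2 - c ^+ 2)) * (2 * x))%R%:E)%E.
  apply: eq_integral => x; rewrite inE /= in_itv /= andbT => cx.
  rewrite -EFinD Hl // Hr // -mulrDr -mulrDl addrC pq c2 /u; congr _%:E; ring.
rewrite (@integral_sqr_ray _ c (fun t => e * (q.[t] * gamma_density b t))) //; last first.
  move=> t; rewrite in_itv /= andbT => t0.
  apply: cvgM; first exact: cvg_cst.
  apply: cvgM; first exact: continuous_horner.
  exact: continuous_gamma_density.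
have [iq eq] := poly_gamma_density q b0.
under eq_integral do rewrite EFinM.
by rewrite integralZl // eq -EFinM.
Unshelve. all: by end_near. Qed.

Lemma limit_poly_orthogonal n m :
  leb.-integrable (support_set gamma)
    (fun x => ((limit_poly mu gamma n).[x] * (limit_poly mu gamma m).[x] *
               weight mu gamma x)%:E) /\
  (\int[leb]_(x in support_set gamma)
     ((limit_poly mu gamma n).[x] * (limit_poly mu gamma m).[x] *
      weight mu gamma x)%:E = (norm_const mu gamma n * (n == m)%:R)%:E)%E.
Proof.
have main q v : (forall x, (limit_poly mu gamma n * limit_poly mu gamma m).[x] * (x + gamma) +
     (limit_poly mu gamma n * limit_poly mu gamma m).[- x] * (x - gamma) =
             2 * x * q.[x ^+ 2 - gamma ^+ 2]) ->
   expR (- gamma ^+ 2) * (Gamma b * moment b q) = v ->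
   leb.-integrable (support_set gamma)
    (fun x => ((limit_poly mu gamma n).[x] * (limit_poly mu gamma m).[x] *
               weight mu gamma x)%:E) /\
   (\int[leb]_(x in support_set gamma)
     ((limit_poly mu gamma n).[x] * (limit_poly mu gamma m).[x] *
      weight mu gamma x)%:E = v%:E)%E.
  move=> h <-; have [i1 i2] := integral_poly_weight h; split.
    by under eq_fun do rewrite -hornerM.
  by under eq_integral do rewrite -hornerM.
have bE : mu + 3 / 2 = b + 1 by rewrite /b; field.
have b10 : 0 < b + 1 by rewrite addr_gt0.
have mom a k l : 0 < a -> moment a (laguerre a k * laguerre a l) =
    k`!%:R * poch a k * (k == l)%:R.
  move=> a0; have [->|kl] := eqVneq k l; last by rewrite moment_laguerre_neq // mulr0.
  by rewrite moment_laguerre_sqr // mulr1.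
have nE := odd_double_half n; have mE := odd_double_half m.
case on : (odd n) nE; case om : (odd m) mE => mE nE.
(* Here (x - gamma)^2 (x + gamma) + (x + gamma)^2 (x - gamma) = 2x t; [momentS] trades the factor t
   for the parameter b + 1. *)
- apply: (main ('X * (laguerre (b + 1) n./2 * laguerre (b + 1) m./2))).
    by move=> x; rewrite !hornerM !horner_limit_poly on om sqrrN -bE hornerX; ring.
  rewrite -momentS mom // /norm_const on.
  have -> : (n == m) = (n./2 == m./2).
    apply/eqP/eqP => [->//|h]; by rewrite -nE -mE h.
  rewrite (_ : n./2%:R + mu + 3 / 2 = b + 1 + n./2%:R); last by rewrite -bE; ring.
  by rewrite Gamma_poch // Gamma_succ //; ring.
(* For opposite parities the contributions of x and -x cancel pointwise. *)
- apply: (main 0).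
    by move=> x; rewrite !hornerM !horner_limit_poly on om sqrrN horner0; ring.
  rewrite (_ : n == m = false) ?linear0 ?mulr0 //.
  by apply: contraFF om => /eqP <-.
- apply: (main 0).
    by move=> x; rewrite !hornerM !horner_limit_poly on om sqrrN horner0; ring.
  rewrite (_ : n == m = false) ?linear0 ?mulr0 //.
  by apply: contraFF on => /eqP ->.
- apply: (main (laguerre b n./2 * laguerre b m./2)).
    by move=> x; rewrite !hornerM !horner_limit_poly on om sqrrN -/b; ring.
  rewrite mom // /norm_const on.
  have -> : (n == m) = (n./2 == m./2).
    apply/eqP/eqP => [->//|h]; by rewrite -nE -mE h.
  rewrite (_ : n./2%:R + mu + 1 / 2 = b + n./2%:R); last by rewrite /b; ring.
  by rewrite Gamma_poch //; ring.
Qed.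

End Orthogonality.

Theorem mainTheorem6 (R : realType) (mu gamma : R) (hmu : - (1 / 2) < mu) :
  (forall (n : nat) (x : R),
     cvg (chihara_scaled mu gamma n x beta @[beta --> +oo])) /\
  (forall n : nat, exists p : {poly R},
     [/\ p \is monic, size p = n.+1 & forall x : R, Y mu gamma n x = p.[x]]) /\
  (forall (n : nat) (x : R),
     Y mu gamma n.*2 x =
       (-1) ^+ n * poch (mu + 1 / 2) n
       * hypergeom [:: - n%:R] [:: mu + 1 / 2] (x ^+ 2 - gamma ^+ 2) /\
     Y mu gamma n.*2.+1 x =
       (-1) ^+ n * poch (mu + 3 / 2) n * (x - gamma)
       * hypergeom [:: - n%:R] [:: mu + 3 / 2] (x ^+ 2 - gamma ^+ 2)) /\
  (forall (n : nat) (x : R),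
     x * Y mu gamma n x =
       Y mu gamma n.+1 x + (-1) ^+ n * gamma * Y mu gamma n x
       + vartheta mu n * (if n is k.+1 then Y mu gamma k x else 0)) /\
  (forall (eps : R) (n : nat) (x : R), x != 0 ->
     Zop mu gamma eps (Y mu gamma n) x = lambda eps n * Y mu gamma n x) /\
  (forall n m : nat,
     lebesgue_measure.-integrable (support_set gamma)
       (fun x => (Y mu gamma n x * Y mu gamma m x * weight mu gamma x)%:E) /\
     (\int[lebesgue_measure]_(x in support_set gamma)
        (Y mu gamma n x * Y mu gamma m x * weight mu gamma x)%:E =
      (norm_const mu gamma n * (n == m)%:R)%:E)%E).
Proof.
split=> [n x|]; first by apply: cvgP; exact: cvg_chihara_scaled.
split=> [n|].
  exists (limit_poly mu gamma n).
  by split=> [||x]; rewrite ?monic_limit_poly ?size_limit_poly ?YE.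
split=> [n x|].
  rewrite !YE horner_limit_poly_double horner_limit_poly_doubleS.
  by rewrite !horner_laguerre; split; first [by []|ring].
split=> [n x|].
  have := limit_poly_recurrence gamma hmu n x.
  by case: n => [|n]; rewrite !YE.
split=> [eps n x x0|n m]; first by rewrite YE limit_poly_eigen.
by rewrite !YE; exact: limit_poly_orthogonal.
Qed.
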